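(* Let $q$ be a prime power, $n\geq 1$, and let $f(y)=\sum_{i=0}^{d}c_iy^{q^i}\in\mathbb{F}_{q^n}[y]$ with $c_d\neq 0$ be an $\mathbb{F}_q$-linearised polynomial of $q$-degree $d$. Consider the subsets of the projective line $\mathrm{PG}(1,q^n)$ $$C_1=\{(x,\mathrm{Tr}(x))_{q^n}\mid x\in\mathbb{F}_{q^n}^*\},\qquad C_2=\{(f(y),y)_{q^n}\mid y\in\mathbb{F}_{q^n}^*\}.$$ If $d<n/2-1$, then $C_1$ and $C_2$ have at least one point in common.
   Context: $\mathrm{Tr}=\mathrm{Tr}_{\mathbb{F}_{q^n}/\mathbb{F}_q}$. For a nonzero vector $(u_0,u_1)\in\mathbb{F}_{q^n}^2$, $(u_0,u_1)_{q^n}$ denotes the projective point of $\mathrm{PG}(1,q^n)=\mathbb{P}(\mathbb{F}_{q^n}^2)$ spanned by it, i.e. the set of its nonzero $\mathbb{F}_{q^n}$-multiples.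
   Formalization: The formal statement assumes d ≥ 1: for d = 0, f(y) = c_0 y and C_2 is the single point (c_0, 1), which lies on C_1 only if Tr(c_0) = 1, so the claim fails for n ≥ 3 and any nonzero c_0 of trace 0. *)

(* Defs.v *)
From HB Require Import structures.
From mathcomp Require Import all_boot all_order all_algebra all_field.
From mathcomp Require Import classical_sets.

Set Implicit Arguments.
Unset Strict Implicit.
Unset Printing Implicit Defensive.

Import Order.TTheory GRing.Theory Num.Theory.
Local Open Scope ring_scope.
Local Open Scope classical_set_scope.

(* Asking for a splittingFieldType is no restriction over a finite base field:
   every finite extension is one (finfield.FinSplittingFieldType), and it is
   Galois (finfield.finField_galois). The trace takes values in the copy 1%AS
   of F inside L. *)
Definition Tr (F : finFieldType) (L : splittingFieldType F) (x : L) : L :=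
  galTrace 1%AS {:L} x.

Definition proj_point (K : fieldType) (u0 u1 : K) : set (K * K) :=
  [set (l * u0, l * u1) | l in [set l : K | l != 0]].

(* In q-degree 0, C2 (linearised_poly q c) below is the single point (c_0 : 1),
   which lies on C1 L if and only if Tr c_0 = 1: a common point can only be
   guaranteed for d > 0. *)
Definition linearised_poly (K : fieldType) (q d : nat) (c : 'I_d.+1 -> K) :
    {poly K} :=
  \sum_(i < d.+1) c i *: 'X^(q ^ i).

Definition C1 (F : finFieldType) (L : splittingFieldType F) :
    set (set (L * L)) :=
  [set proj_point x (Tr x) | x in [set x : L | x != 0]].
Arguments C1 {F} L _.

Definition C2 (K : fieldType) (f : {poly K}) : set (set (K * K)) :=
  [set proj_point f.[y] y | y in [set y : K | y != 0]].

(* Main.v *)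
Require Import Defs.
From HB Require Import structures.
From mathcomp Require Import all_boot all_order all_algebra all_field.
From mathcomp Require Import classical_sets.
From mathcomp Require Import all_fingroup all_solvable zify lra.

Set Implicit Arguments.
Unset Strict Implicit.
Unset Printing Implicit Defensive.

Import Order.TTheory GRing.Theory Num.Theory.
Local Open Scope ring_scope.

(* A common point exists as soon as Tr (f(y)/y) = 1 for some y != 0. Write
   T(y) = Tr (f(y)/y) = \sum_(i <= d, j < n) c_i^(q^j) y^((q^i - 1) q^j).
   If T never takes the value 1 then (T - 1)^(q-1) = 1 on all nonzero y, so in
   the expansion of (T - 1)^(q-1) the total coefficient of the monomials y^e with
   e = E mod q^n - 1 vanishes for every E != 0 mod q^n - 1. Up to the factor q - 1,
   the exponent (q^i - 1) q^j is the sum of the q^k for k in the cyclic interval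
   [j, j + i) of Z/n, so expansion terms are families of q - 1 such arcs. Let E be the
   exponent of u arcs [0, d) and v arcs [1, d + 1), with u + v = q - 1 and u, v
   as equal as possible. A carry analysis in base q shows that no other family
   of q - 1 arcs of length at most d reaches E: the total coefficient of y^E
   is 'C(q - 1, u) c_d^(u + v q), which is nonzero. *)

Section ArcWeights.
Local Open Scope nat_scope.

(* Membership of [k] in the cyclic interval [j, j + i) of Z/n, for [j, k < n]. *)
Definition arc_mem (n i j k : nat) : bool :=
  if j <= k then k - j < i else k + n - j < i.

Definition arc_weight (q n i j : nat) : nat :=
  \sum_(k < n) arc_mem n i j k * q ^ k.

Lemma arc_weightS (q n i j : nat) : i < n -> j < n ->
  arc_weight q n i.+1 j = arc_weight q n i j + q ^ ((j + i) %% n).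
Proof.
move=> lt_in lt_jn.
have lt_mn : (j + i) %% n < n by rewrite ltn_mod; lia.
have : (j + i) %% n = j + i \/ (j + i) %% n + n = j + i.
  have [/modn_small|le_n] := ltnP (j + i) n; first by left.
  by right; rewrite -[in LHS](subnK le_n) modnDr modn_small; lia.
move: (_ %% n) lt_mn => m lt_mn mE.
rewrite /arc_weight (bigD1 (Ordinal lt_mn)) //= [in RHS](bigD1 (Ordinal lt_mn)) //=.
have -> : arc_mem n i.+1 j m by rewrite /arc_mem; case: ifP; lia.
have -> : arc_mem n i j m = false by rewrite /arc_mem; case: ifP; lia.
rewrite mul0n mul1n add0n addnC; congr (_ + _).
apply: eq_bigr => k; rewrite -val_eqE /= => ne; congr (nat_of_bool _ * _).
by rewrite /arc_mem; have := ltn_ord k; case: ifP; lia.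
Qed.

Lemma arc_weight0 (q n j : nat) : arc_weight q n 0 j = 0.
Proof.
by apply: big1 => k _; rewrite /arc_mem !ltn0 if_same.
Qed.

Lemma expn_mod_predX (q n k : nat) : 0 < q ->
  q ^ (k %% n) = q ^ k %[mod (q ^ n).-1].
Proof.
move=> q_gt0; have qn1 : q ^ n = 1 %[mod (q ^ n).-1].
  by rewrite -{1}(prednK (n := q ^ n)) ?expn_gt0 ?q_gt0 // -addn1 modnDl.
rewrite {2}(divn_eq k n) expnD [_ * n]mulnC expnM -[RHS]modnMml.
by rewrite -(modnXm _ _ (q ^ n)) qn1 modnXm exp1n modnMml mul1n.
Qed.

Lemma arc_weight_mod (q n i j : nat) : 0 < q -> i <= n -> j < n ->
  (q ^ i).-1 * q ^ j = q.-1 * arc_weight q n i j %[mod (q ^ n).-1].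
Proof.
move=> q_gt0 + lt_jn; elim: i => [|i IH] lt_in.
  by rewrite arc_weight0 muln0.
rewrite arc_weightS // mulnDr -modnDm -IH 1?ltnW // -[(q.-1 * q ^ _) %% _]modnMmr.
rewrite expn_mod_predX // modnMmr modnDm expnD; congr (_ %% _).
have: 0 < q ^ i by rewrite expn_gt0 q_gt0.
rewrite expnS; case: (q ^ i) => // A _; case: q q_gt0 {IH} => // r _ /=.
by rewrite plusE mulnDl -mulnA [A.+1 * _]mulnC.
Qed.

(* [g] is the sequence of carries when the base [q] digits [a] are computed from
   the unnormalised digits [b] and the initial carry [g0]. *)
Lemma carries (q : nat) (a b : nat -> nat) (n g0 : nat) :
  (forall k, k < n -> a k < q) ->
  \sum_(k < n) a k * q ^ k = \sum_(k < n) b k * q ^ k + g0 ->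
  exists g : nat -> nat, [/\ g 0 = g0, g n = 0
    & forall k, k < n -> a k + q * g k.+1 = b k + g k].
Proof.
elim: n a b g0 => [|n IH] a b g0 lt_aq.
  rewrite !big_ord0 => E; exists (fun=> g0); split=> //; lia.
rewrite !big_ord_recl !expn0 !muln1.
under eq_bigr do rewrite /= expnS mulnCA.
under [in RHS]eq_bigr do rewrite /= expnS mulnCA.
rewrite -!big_distrr /= => E.
have a0q := lt_aq 0 isT.
set A := \sum_(_ < n) _ in E; set B := \sum_(_ < n) _ in E.
have [h Eh]: exists h, b 0 + g0 = a 0 + q * h /\ A = B + h.
  exists (A - B).
  have : B <= A by nia.
  move=> BA; split; nia.
have [g [g0E gnE gE]] := IH (a \o S) (b \o S) h (fun k => lt_aq k.+1) Eh.2.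
exists (fun k => if k is k'.+1 then g k' else g0); split=> //.
by case=> [|k] lt_k /=; [rewrite g0E Eh.1|apply: gE].
Qed.

Lemma sum_arc_mem (n i j : nat) : i <= n -> j < n ->
  \sum_(k < n) arc_mem n i j k = i.
Proof.
move=> + lt_jn; suff E : i <= n -> arc_weight 1 n i j = i.
  by move=> /E {2}<-; apply: eq_bigr => k _; rewrite exp1n muln1.
elim: i => [|i IH] lt_in; first by rewrite arc_weight0.
by rewrite arc_weightS // IH 1?ltnW // exp1n addn1.
Qed.

Lemma arc_combination_inj (T : finType) (q n d u v : nat) (I J : T -> nat) :
  1 < q -> 0 < d -> d.*2 + 2 < n ->
  u + v = q.-1 -> u.*2 <= q -> v.*2 < q -> #|T| = q.-1 ->
  (forall t, I t <= d) -> (forall t, J t < n) ->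
  \sum_t arc_weight q n (I t) (J t) =
    u * arc_weight q n d 0 + v * arc_weight q n d 1 %[mod \sum_(k < n) q ^ k] ->
  [/\ forall t, I t = d, forall t, J t <= 1 & #|[set t | J t == 0]| = u].
Proof.
move=> q_gt1 d_gt0 lt_dn uvE le_uq lt_vq cardT leI ltJ.
pose phi k := \sum_t arc_mem n (I t) (J t) k.
pose psi k := u * arc_mem n d 0 k + v * arc_mem n d 1 k.
have -> : \sum_t arc_weight q n (I t) (J t) = \sum_(k < n) phi k * q ^ k.
  rewrite exchange_big; apply: eq_bigr => k _; exact/esym/big_distrl.
have -> : u * arc_weight q n d 0 + v * arc_weight q n d 1 = \sum_(k < n) psi k * q ^ k.
  rewrite /arc_weight !big_distrr -big_split; apply: eq_bigr => k _ /=.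
  by rewrite !mulnA -mulnDl.
(* No arc of length at most [d] contains both [x] and [y]. *)
have disj x y : x < y -> d <= y - x <= n - d -> y < n -> phi x + phi y <= q.-1.
  move=> lt_xy dist lt_yn; rewrite -cardT -sum1_card /phi -big_split /=.
  apply: leq_sum => t _; have := leI t; have := ltJ t.
  by rewrite /arc_mem; do 2 case: ifP; lia.
have phi_ltq k : phi k < q.
  apply: (@leq_ltn_trans #|T|); last by rewrite cardT; lia.
  by rewrite -sum1_card; apply: leq_sum => t _; apply: leq_b1.
have arc0 k : arc_mem n d 0 k = (k < d) by rewrite /arc_mem leq0n subn0.
have arc1 k : arc_mem n d 1 k = (0 < k <= d) by rewrite /arc_mem; case: ifP; lia.
have psi0 : psi 0 = u by rewrite /psi arc0 arc1 d_gt0 muln1 muln0 addn0.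
have psid : psi d = v by rewrite /psi arc0 arc1 d_gt0 ltnn leqnn muln0 muln1.
have psi_gap k : d < k -> psi k = 0.
  move=> lt_dk; rewrite /psi arc0 arc1 [k <= d]leqNgt lt_dk andbF.
  by rewrite ltnNge (ltnW lt_dk) !muln0.
have psi_ltq k : psi k < q.
  by rewrite /psi; do 2 case: (arc_mem _ _ _ _); lia.
set S := \sum_(k < n) q ^ k.
set Phi := \sum_(k < n) phi k * q ^ k.
set Psi := \sum_(k < n) psi k * q ^ k.
have Psi_lt : Psi < S.
  have n_gt0 : 0 < n by lia.
  apply: (@leq_trans (q ^ d.+1)); last first.
    rewrite /S -(prednK n_gt0) big_ord_recr /=; apply: leq_trans (leq_addl _ _).
    by rewrite leq_pexp2l; lia.
  have -> : q ^ d.+1 = (\sum_(k < d.+1) q.-1 * q ^ k).+1.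
    by rewrite -big_distrr /= -predn_exp prednK // expn_gt0; lia.
  rewrite ltnS (big_ord_widen n (fun k => q.-1 * q ^ k)); last by lia.
  rewrite [leqRHS]big_mkcond; apply: leq_sum => k _.
  case: ltnP => [_|le_dk]; last by rewrite psi_gap.
  by rewrite leq_mul2r; have := psi_ltq k; lia.
have Psi_gt0 : 0 < Psi.
  have n_gt0 : 0 < n by lia.
  by rewrite /Psi -(prednK n_gt0) big_ord_recl /= psi0; lia.
have Phi_le : Phi <= q.-1 * S.
  rewrite /S big_distrr; apply: leq_sum => k _.
  by rewrite leq_mul2r; have := phi_ltq k; lia.
rewrite (modn_small Psi_lt) => PhiE.
set m := Phi %/ S.
have {}PhiE : Phi = Psi + m * S by rewrite addnC -PhiE -divn_eq.
have m_lt : m < q.-1 by nia.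
have [g [g0 _ gE]] : exists g : nat -> nat, [/\ g 0 = 0, g n = 0
    & forall k, k < n -> phi k + q * g k.+1 = psi k + m + g k].
  apply: carries => // ; rewrite addn0 -/Phi PhiE /S big_distrr -big_split.
  by apply: eq_bigr => k _ /=; rewrite mulnDl.
have g_le1 k : k <= n -> g k <= 1.
  elim: k => [|k IH] lt_kn; first by rewrite g0.
  have := gE k lt_kn; have := IH (ltnW lt_kn); have := psi_ltq k; nia.
have g_gap k : d < k -> k < n -> g k.+1 = 0.
  move=> lt_dk lt_kn; have := gE k lt_kn; have := g_le1 k (ltnW lt_kn).
  rewrite psi_gap //; nia.
(* At the gap positions [d.+1] and [d.*2 + 2] the digits are [m + g d.+1] and [m],
   so [disj] bounds [m] enough to exclude carries out of [0] and [d]; then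
   [phi 0 + phi d >= u + v + 2 m]. *)
have m0 : m = 0.
  have D1 : phi 0 + phi d <= q.-1 by apply: disj; lia.
  have D2 : phi d.+1 + phi (d.*2 + 2) <= q.-1 by apply: disj; lia.
  have E0 : phi 0 + q * g 1 = u + m + 0 by rewrite gE ?psi0 ?g0; lia.
  have Ed : phi d + q * g d.+1 = v + m + g d by rewrite gE ?psid; lia.
  have E1 : phi d.+1 + q * g d.+2 = 0 + m + g d.+1 by rewrite gE ?psi_gap; lia.
  have E2 : phi (d.*2 + 2) + q * g (d.*2 + 2).+1 = 0 + m + g (d.*2 + 2).
    by rewrite gE ?psi_gap; lia.
  have gd2 : g d.+2 = 0 by apply: g_gap; lia.
  have g2d : g (d.*2 + 2) = 0 by rewrite addn2; apply: g_gap; lia.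
  have g2d' : g (d.*2 + 2).+1 = 0 by apply: g_gap; lia.
  have gd_le : g d <= 1 by apply: g_le1; lia.
  have : g d.+1 <= 1 by apply: g_le1; lia.
  rewrite gd2 g2d g2d' in E1 E2.
  rewrite leq_eqVlt ltnS leqn0 => /orP[]/eqP gd1; rewrite gd1 in Ed E1; last first.
    have g1 : g 1 = 0 by nia.
    rewrite g1 in E0; lia.
  lia.
have phiE k : k < n -> phi k = psi k.
  have gS i : i < n -> g i = 0 -> phi i = psi i /\ g i.+1 = 0.
    move=> lt_in gi0; have := gE i lt_in; rewrite m0 gi0 !addn0.
    have := psi_ltq i; have := g_le1 _ lt_in.
    by case: (g i.+1) => [|[|]] //; lia.
  suff gk0 i : i <= n -> g i = 0 by move=> lt_kn; case: (gS k lt_kn (gk0 _ (ltnW lt_kn))).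
  by elim: i => [//|i IH] lt_in; case: (gS i lt_in (IH (ltnW lt_in))).
have le_dn : d <= n by lia.
have IE t : I t = d.
  have : \sum_t (d - I t) == 0.
    rewrite sumnB => [|t' _]; last exact: leI.
    rewrite sum_nat_const cardT subn_eq0 -uvE mulnDl.
    rewrite -{1}(@sum_arc_mem n d 0) // ?(ltn_trans d_gt0) //; last by lia.
    rewrite -{2}(@sum_arc_mem n d 1) //; last by lia.
    rewrite !big_distrr -big_split /=.
    rewrite (eq_bigr (fun k : 'I_n => phi k)) => [|k _]; last exact/esym/phiE.
    rewrite exchange_big; apply: leq_sum => t' _.
    by rewrite sum_arc_mem // (leq_trans (leI t')).
  rewrite sum_nat_eq0 => /forallP/(_ t) /=; rewrite subn_eq0 => ?.
  by apply/eqP; rewrite eqn_leq leI.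
have in_psi t k : k < n -> arc_mem n d (J t) k -> k <= d.
  move=> lt_kn kt; rewrite leqNgt; apply/negP => lt_dk.
  by have := phiE k lt_kn; rewrite psi_gap // /phi (bigD1 t) //= IE kt.
have JE t : J t <= 1.
  have le_Jd : J t <= d.
    by apply: (in_psi t) => //; rewrite /arc_mem leqnn subnn.
  have : J t + d.-1 <= d by apply: (in_psi t); rewrite /arc_mem ?leq_addr ?addKn; lia.
  lia.
split=> //; rewrite -psi0 -phiE; last by lia.
rewrite -sum1dep_card big_mkcond /=; apply: eq_bigr => t _.
by have := JE t; rewrite IE /arc_mem; case: (J t) => [|[|]] //=; lia.
Qed.

End ArcWeights.

Lemma dvdn_bin_pfactor (p e k : nat) :
  prime p -> (0 < k < p ^ e)%N -> (p %| 'C(p ^ e, k))%N.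
Proof.
case: k => // k p_pr /= lt_kp; apply: contraLR lt_kp => ndvd.
rewrite -leqNgt; apply: dvdn_leq => //.
have: (p ^ e %| k.+1 * 'C(p ^ e, k.+1))%N by rewrite -mul_bin_diag dvdn_mulr.
by rewrite Gauss_dvdl // coprimeXl ?prime_coprime.
Qed.

Lemma bin_predX_pchar (R : nzRingType) (p e k : nat) :
  p \in [pchar R] -> (k < p ^ e)%N -> ('C((p ^ e).-1, k))%:R = (-1) ^+ k :> R.
Proof.
move=> charp; have p_pr := pcharf_prime charp.
elim: k => [|k IH] lt_kp; first by rewrite bin0 expr0.
have := dvdn_bin_pfactor p_pr (e := e) (k := k.+1) lt_kp.
rewrite (dvdn_pcharf charp) -{1}(prednK (n := p ^ e)) ?expn_gt0 ?prime_gt0 //.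
rewrite binS natrD IH ?(ltnW lt_kp) //.
by rewrite addr_eq0 exprS mulN1r => /eqP.
Qed.

Lemma sum_pow_eq1_coef0 (K : finFieldType) (W : finType) (a : W -> K)
    (e : W -> nat) (E : nat) :
  (forall y : K, y != 0 -> \sum_w a w * y ^+ e w = 1) ->
  (E != 0 %[mod #|K|.-1])%N ->
  \sum_(w | (e w == E %[mod #|K|.-1])%N) a w = 0.
Proof.
set N := #|K|.-1 => sum1 E_nz.
have NE : N.+1 = #|K| by apply/prednK/ltnW/finNzRing_gt1.
have N_gt0 : (0 < N)%N by rewrite -ltnS NE finNzRing_gt1.
have powN (y : K) : y != 0 -> y ^+ N = 1.
  move=> y_nz; apply: (mulfI y_nz).
  by rewrite -exprS NE expf_card mulr1.
pose P : {poly K} := \sum_w a w *: 'X^(e w %% N) - 1.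
have P0 : P = 0.
  apply/eqP/negPn/negP => P_nz.
  have sizeP : (size P <= N)%N.
    rewrite (leq_trans (size_polyD _ _)) // size_polyN size_poly1 geq_max N_gt0 andbT.
    apply: (leq_trans (size_sum _ _ _)); apply/bigmax_leqP => w _.
    by rewrite (leq_trans (size_scale_leq _ _)) // size_polyXn ltn_mod.
  suff rootsP : all (root P) (enum (predC1 (0 : K))).
    have := max_poly_roots P_nz rootsP (enum_uniq _).
    by rewrite -cardE cardC1 -/N ltnNge sizeP.
  apply/allP => y; rewrite mem_enum inE /= => y_nz.
  rewrite rootE /P hornerD hornerN hornerC horner_sum subr_eq0 -[X in _ == X](sum1 y y_nz).
  apply/eqP/eq_bigr => w _; rewrite hornerZ hornerXn; congr (_ * _).
  by rewrite [in RHS](divn_eq (e w) N) exprD mulnC exprM powN // expr1n mul1r.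
have := congr1 (fun Q : {poly K} => Q`_(E %% N)) P0.
rewrite coef0 coefB coef1 coef_sum; move: E_nz; rewrite mod0n => /negbTE ->.
rewrite subr0 => coefE; rewrite -[RHS]coefE.
rewrite big_mkcond; apply: eq_bigr => w _; rewrite coefZ coefXn eq_sym.
by case: eqP => _; rewrite ?mulr1 ?mulr0.
Qed.

Lemma sum_two_values (T : finType) (J : T -> nat) (u v : nat) (h : nat -> nat) :
  (forall t, J t <= 1)%N -> #|T| = (u + v)%N -> #|[set t | J t == 0%N]| = u ->
  (\sum_t h (J t) = u * h 0 + v * h 1)%N.
Proof.
move=> J01 cardT card0; rewrite (bigID (fun t => J t == 0%N)) /=; congr (_ + _)%N.
  rewrite (eq_bigr (fun=> h 0)) => [|t /eqP-> //].
  by rewrite sum_nat_const -card0 cardsE.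
rewrite (eq_bigr (fun=> h 1)) => [|t Jt]; last by congr h; have := J01 t; lia.
rewrite sum_nat_const; congr (_ * _)%N.
have := cardC [pred t | J t == 0%N]; rewrite cardT.
by rewrite -{1}card0 cardsE => /addnI <-; apply: eq_card.
Qed.

Lemma sum_frobenius_eq1 (K : finFieldType) (p e n d : nat) (c : 'I_d.+1 -> K) :
  let q := (p ^ e)%N in
  p \in [pchar K] -> #|K| = (q ^ n)%N -> c ord_max != 0 ->
  (0 < d)%N -> (d.*2 + 2 < n)%N ->
  exists2 y, y != 0 &
    \sum_(j < n) (\sum_i c i * y ^+ (q ^ i).-1) ^+ (q ^ j) = 1.
Proof.
move=> q charK cardK cd_nz d_gt0 lt_dn.
have p_pr := pcharf_prime charK.
have Kq k : [pchar K].-nat (q ^ k)%N.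
  by rewrite !pnatX (eq_pnat _ (pcharf_eq charK)) pnat_id.
have n_gt1 : (1 < n)%N by lia.
have q_gt1 : (1 < q)%N.
  have := finNzRing_gt1 K; rewrite cardK ltnNge; apply: contraTT.
  rewrite -leqNgt => q_le1; rewrite negbK.
  by apply: leq_trans (_ : 1 ^ n <= 1)%N; rewrite ?leq_exp2r ?exp1n //; lia.
have q_gt0 := ltnW q_gt1.
pose tr (z : K) := \sum_(j < n) z ^+ (q ^ j).
have expD k : {morph (fun x : K => x ^+ (q ^ k)) : x y / x + y}.
  by move=> x y; apply: exprDn_pchar.
have exp0 k : 0 ^+ (q ^ k) = 0 :> K by rewrite expr0n expn_eq0 -leqn0 leqNgt q_gt0.
have trX z : tr z ^+ q = tr z.
  rewrite /tr -[X in _ ^+ X]expn1 (big_morph _ (expD 1%N) (exp0 1%N)) expn1.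
  under eq_bigr do rewrite -exprM -expnSr.
  case: n n_gt1 cardK {tr lt_dn} => // m _ cardK.
  by rewrite big_ord_recr big_ord_recl /= -cardK expf_card expn0 expr1 addrC.
set z := fun y : K => \sum_i c i * y ^+ (q ^ i).-1.
have [/existsP[y /andP[y_nz /eqP]]|/existsPn no_y] :=
    boolP [exists y, (y != 0) && (tr (z y) == 1)]; first by exists y.
have tr_neq1 y : y != 0 -> tr (z y) != 1 by move=> y_nz; have := no_y y; rewrite y_nz.
pose W := {ffun 'I_q.-1 -> 'I_d.+1 * 'I_n}.
pose i0n : 'I_n := Ordinal (ltnW n_gt1); pose i1n : 'I_n := Ordinal n_gt1.
(* The [-1] of [tr (z y) - 1] is merged into the coefficient of index [(0, 0)]. *)
pose cc (x : 'I_d.+1 * 'I_n) : K :=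
  c x.1 ^+ (q ^ x.2) - (x == (ord0, i0n))%:R.
pose ee (x : 'I_d.+1 * 'I_n) : nat := ((q ^ x.1).-1 * q ^ x.2)%N.
have trE y : tr (z y) - 1 = \sum_x cc x * y ^+ ee x.
  under [RHS]eq_bigr do rewrite /cc mulrBl.
  rewrite sumrB; congr (_ - _); last first.
    rewrite (bigD1 (ord0, i0n)) // eqxx big1 => [|x /negbTE->]; last by rewrite mul0r.
    by rewrite /ee /= expn0 mul0n expr0 mulr1 addr0.
  rewrite -(pair_bigA _ (fun (i : 'I_d.+1) (j : 'I_n) => c i ^+ (q ^ j) * y ^+ ((q ^ i).-1 * q ^ j))) /=.
  rewrite exchange_big; apply: eq_bigr => j _.
  rewrite (big_morph _ (expD j) (exp0 j)); apply: eq_bigr => i _.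
  by rewrite exprMn exprM.
have sum1 y : y != 0 ->
    \sum_(w : W) (\prod_t cc (w t)) * y ^+ (\sum_t ee (w t)) = 1.
  move=> y_nz; have tr_nz : tr (z y) - 1 != 0 by rewrite subr_eq0 tr_neq1.
  apply: etrans (_ : (tr (z y) - 1) ^+ q.-1 = 1).
    rewrite trE -[X in _ ^+ X](card_ord q.-1) -prodr_const bigA_distr_bigA.
    by apply: eq_bigr => w _; rewrite big_split -expr_sum.
  apply: (mulfI tr_nz); rewrite -exprS prednK // mulr1.
  have := expD 1%N (tr (z y) - 1) 1.
  by rewrite subrK /= expn1 trX expr1n => {2}->; rewrite addrK.
set u := uphalf q.-1; set v := q.-1./2.
have uvE : (u + v)%N = q.-1 by rewrite /u /v; lia.
pose Psi := (u * arc_weight q n d 0 + v * arc_weight q n d 1)%N.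
pose S := (\sum_(k < n) q ^ k)%N.
have NE : #|K|.-1 = (q.-1 * S)%N by rewrite cardK predn_exp.
have q1_gt0 : (0 < q.-1)%N by lia.
have inj (I J : 'I_q.-1 -> nat) :
    (forall t, I t <= d)%N -> (forall t, J t < n)%N ->
    (\sum_t arc_weight q n (I t) (J t) = Psi %[mod S])%N ->
    [/\ forall t, I t = d, forall t, (J t <= 1)%N & #|[set t | J t == 0%N]| = u].
  by move=> *; apply: (@arc_combination_inj _ q n d u v); rewrite ?card_ord // /u /v; lia.
have Psi_nz : (q.-1 * Psi != 0 %[mod #|K|.-1])%N.
  rewrite NE -(muln0 q.-1) -!muln_modr eqn_pmul2l //.
  apply/eqP => Psi0; have [] := inj (fun=> 0%N) (fun=> 0%N).
  - by [].
  - by move=> t; apply: ltnW.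
  - by rewrite Psi0 big1 // => t _; rewrite arc_weight0.
  - by move=> /(_ (Ordinal q1_gt0)) d0; rewrite -d0 in d_gt0.
have := sum_pow_eq1_coef0 sum1 Psi_nz.
pose good (w : W) := [forall t, (w t).1 == ord_max] && [forall t, (w t).2 <= 1]%N
   && (#|[set t | (w t).2 == i0n]| == u).
have goodE (w : W) : (\sum_t ee (w t) == q.-1 * Psi %[mod #|K|.-1])%N = good w.
  have -> : (\sum_t ee (w t) == q.-1 * Psi %[mod #|K|.-1])%N =
      (\sum_t arc_weight q n (w t).1 (w t).2 == Psi %[mod S])%N.
    rewrite -[RHS](eqn_pmul2l q1_gt0) !muln_modr -NE big_distrr /=.
    rewrite -modn_summ -[in RHS]modn_summ cardK; congr (_ %% _ == _)%N.
    apply: eq_bigr => t _; apply: arc_weight_mod => //.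
    by have := ltn_ord (w t).1; lia.
  apply/eqP/andP => [/inj[]|].
  - by move=> t; rewrite -ltnS.
  - by [].
  - move=> w1 w2 card0; split; last exact/eqP.
    by apply/andP; split; apply/forallP => t //; apply/eqP/val_inj/w1.
  - move=> [/andP[/forallP w1 /forallP w2] /eqP card0].
    under eq_bigr => t _ do rewrite (eqP (w1 t)).
    by rewrite (sum_two_values (u := u) (v := v) (arc_weight q n d)) // card_ord uvE.
rewrite (eq_bigl _ _ goodE) => sum0.
pose C := c ord_max ^+ (u * q ^ 0 + v * q ^ 1).
have prodE (w : W) : good w -> \prod_t cc (w t) = C.
  move=> /andP[/andP[/forallP w1 /forallP w2] /eqP card0].
  rewrite /C -(sum_two_values (J := fun t => (w t).2) (expn q) w2) ?card_ord //.
  rewrite expr_sum; apply: eq_bigr => t _; rewrite /cc (eqP (w1 t)).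
  case: (w t) (eqP (w1 t)) => i j /= ->; rewrite xpair_eqE.
  by rewrite -val_eqE /= (gtn_eqF d_gt0) /= subr0.
pose h (A : {set 'I_q.-1}) : W := [ffun t => (ord_max, if t \in A then i0n else i1n)].
pose h' (w : W) := [set t | (w t).2 == i0n].
have hK A : h' (h A) = A.
  by apply/setP => t; rewrite inE ffunE /=; case: (t \in A).
have := sum0; rewrite (eq_bigr _ prodE) (reindex_onto h h') => [|w]; last first.
  move=> /andP[/andP[/forallP w1 /forallP w2] _]; apply/ffunP => t.
  rewrite ffunE inE; case: (w t) (w1 t) (w2 t) => i j /= /eqP-> j_le1.
  by congr (_, _); apply/val_inj; case: eqP => [->//|/eqP]; rewrite -val_eqE /=; lia.
rewrite (eq_bigl (fun A : {set 'I_q.-1} => A \in [set A : {set 'I_q.-1} | #|A| == u])); last first.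
  move=> A; rewrite hK eqxx andbT inE /good -/(h' (h A)) hK.
  suff -> : [forall t, (h A t).1 == ord_max] && [forall t, (h A t).2 <= 1]%N by [].
  by apply/andP; split; apply/forallP => t; rewrite ffunE //=; case: ifP.
rewrite sumr_const card_draws card_ord => /eqP; rewrite -mulr_natr mulf_eq0.
rewrite expf_eq0 (negbTE cd_nz) andbF (bin_predX_pchar charK) ?signr_eq0 //.
by rewrite -/q /u; lia.
Qed.

Lemma card_finField_pchar (F : finFieldType) :
  exists p e : nat, p \in [pchar F] /\ #|F| = (p ^ e)%N.
Proof.
have /is_abelemP[p p_pr /abelem_pgroup] := finField_is_abelem F.
rewrite /pgroup cardsT => /p_natP[e cardF].
by exists p, e; split=> //; apply: card_finPcharP cardF p_pr.
Qed.

Lemma Tr_frobenius (F : finFieldType) (L : splittingFieldType F) (x : L) :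
  Tr x = \sum_(j < \dim {:L}) x ^+ (#|F| ^ j).
Proof.
have galL : galois 1%AS {:L} by apply/finField_galois/sub1v.
have [a gen_a aE] := finField_galois_generator (sub1v {:L}).
have /eqP defG := gen_a.
have aX j : (a ^+ j)%g x = x ^+ (#|F| ^ j).
  elim: j => [|j IH]; first by rewrite expg0 gal_id expn0 expr1.
  by rewrite expgSr galM ?memvf // IH aE ?memvf // dimv1 expn1 -exprM -expnSr.
have order_a : #[a]%g = \dim {:L}.
  by rewrite orderE -defG -(galois_dim galL) dimv1 divn1.
rewrite /Tr /galTrace -order_a.
have inj_pow : {in [set: 'I_#[a]%g] &, injective (fun j : 'I_#[a]%g => (a ^+ j)%g)}.
  move=> i j _ _ /eqP; rewrite eq_expg_mod_order !modn_small // => /eqP; exact: val_inj.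
have -> : 'Gal({:L} / 1%AS)%g = [set (a ^+ (j : 'I_#[a]%g))%g | j in [set: 'I_#[a]%g]].
  apply/setP => y; rewrite defG; apply/idP/imsetP => [/cyclePmin[i lt_i ->]|[i _ ->]].
    by exists (Ordinal lt_i).
  exact: mem_cycle.
rewrite big_imset //=; apply: eq_big => [j|j _]; last exact: aX.
by rewrite inE.
Qed.

Local Open Scope classical_set_scope.

Theorem theorem6p7 (q n : nat) (F : finFieldType) (L : splittingFieldType F)
    (hq : #|F| = q) (hn : \dim {:L} = n)
    (d : nat) (c : 'I_d.+1 -> L) (hc : c ord_max != 0)
    (hd0 : (0 < d)%N) (hd : (d%:R < n%:R / 2 - 1 :> rat)) :
  C1 L `&` C2 (linearised_poly q c) !=set0.
Proof.
have lt_dn : (d.*2 + 2 < n)%N.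
  by rewrite -(ltr_nat rat) natrD -muln2 natrM; lra.
have [p [e [charF cardF]]] := card_finField_pchar F.
have qE : q = (p ^ e)%N by rewrite -hq.
have [y y_nz trE] : exists2 y : L, y != 0 &
    \sum_(j < n) (\sum_i c i * y ^+ (q ^ i).-1) ^+ (q ^ j) = 1.
  rewrite qE; apply: (@sum_frobenius_eq1 (finvect_type L)) => //.
    by rewrite (pchar_lalg L).
  have := card_vspace (T := finvect_type L) {: finvect_type L}.
  by rewrite card_vspacef hn cardF.
have q_gt0 : (0 < q)%N by rewrite -hq; apply: ltnW (finNzRing_gt1 F).
set z : L := \sum_(i < d.+1) _ in trE.
have Trz : Tr z = 1 by rewrite Tr_frobenius hn hq.
have fE : (linearised_poly q c).[y] = y * z.
  rewrite /linearised_poly horner_sum big_distrr; apply: eq_bigr => i _ /=.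
  by rewrite hornerZ hornerXn mulrCA -exprS prednK // expn_gt0 q_gt0.
exists (proj_point z (Tr z)); split.
  exists z => //=; apply: contra_eq_neq Trz => ->.
  by rewrite /Tr raddf0 eq_sym oner_eq0.
exists y => //=; rewrite fE Trz; apply/seteqP; split=> _ [l l_nz <-] /=.
  by exists (l * y); rewrite /= ?mulf_neq0 // mulr1 mulrA.
by exists (l / y); rewrite /= ?mulf_neq0 ?invr_eq0 // mulr1 mulrA divfK.
Qed.
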